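(* For every integer $J\ge2$ and every $\psi\in\mathcal{D}_G[0,\infty)$, where $G=\mathbb{R}^J_+$, there exists a unique solution $(\phi,\eta)$ to the $J$-dimensional GPS ESP for $\psi$. Moreover, the associated GPS extended Skorokhod map $\bar\Gamma:\psi\mapsto\phi$ is Lipschitz continuous on $\mathcal{D}_G[0,\infty)$.
   Context: $\mathcal{D}[0,\infty)$ is the space of $\mathbb{R}^J$-valued right-continuous functions with left limits on $[0,\infty)$, and $\mathcal{D}_G[0,\infty)$ is the subspace of $f$ with $f(0)\in G$; function spaces carry the topology of uniform convergence on compact sets. Lipschitz continuity means: there is a constant $\ell<\infty$ such that $\sup_{t\in[0,T]}|\bar\Gamma(\psi_1)(t)-\bar\Gamma(\psi_2)(t)|\le\ell\sup_{t\in[0,T]}|\psi_1(t)-\psi_2(t)|$ for all $T<\infty$ and all $\psi_1,\psi_2\in\mathcal{D}_G[0,\infty)$. ESP for $(G,d(\cdot))$: given $\psi\in\mathcal{D}_G[0,\infty)$, a pair $(\phi,\eta)\in\mathcal{D}_G[0,\infty)\times\mathcal{D}[0,\infty)$ solves the ESP for $\psi$ if $\phi(0)=\psi(0)$ and for all $t\ge0$: $\phi(t)=\psi(t)+\eta(t)$; $\phi(t)\in G$; $\eta(t)-\eta(s)\in\overline{\mathrm{co}}[\cup_{u\in(s,t]}d(\phi(u))]$ for every $s\in[0,t]$; and $\eta(t)-\eta(t-)\in\overline{\mathrm{co}}[d(\phi(t))]$, where $\overline{\mathrm{co}}$ denotes closed convex hull. The extended Skorokhod map $\bar\Gamma$ assigns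 to $\psi$ the set of $\phi$ such that $(\phi,\phi-\psi)$ solves the ESP for $\psi$. GPS ESP: fix a weight vector $\bar\alpha\in\mathbb{R}^J$ with all $\bar\alpha_i>0$ and $\sum_{i=1}^J\bar\alpha_i=1$. With $\{e_i\}$ the standard basis of $\mathbb{R}^J$, set $n_i=e_i$ for $i=1,\dots,J$, $n_{J+1}=d_{J+1}=\sum_{i=1}^Je_i/\sqrt J$, and for $i,j\in\{1,\dots,J\}$, $(d_i)_i=1$ and $(d_i)_j=-\bar\alpha_j/(1-\bar\alpha_i)$ for $j\ne i$. Then $G=\mathbb{R}^J_+=\cap_{i=1}^{J+1}\{x:\langle x,n_i\rangle\ge0\}$, $d(x)=\{0\}$ for $x\in G^\circ$ and $d(x)=\{\sum_{i\in I(x)}\alpha_id_i:\alpha_i\ge0\}$ for $x\in\partial G$, where $I(x)=\{i\in\{1,\dots,J+1\}:\langle x,n_i\rangle=0\}$. *)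

(* Defs.v *)
From mathcomp Require Import all_boot all_order all_algebra.
From mathcomp Require Import all_classical all_reals all_analysis.

Set Implicit Arguments.
Unset Strict Implicit.
Unset Printing Implicit Defensive.

Import Order.TTheory GRing.Theory Num.Theory.
Import numFieldNormedType.Exports.

Local Open Scope classical_set_scope.
Local Open Scope ring_scope.

(* Functions on [0, +oo) are represented by total functions on R, whose values
   at negative times are never used: the definitions below only evaluate them
   at nonnegative times, and equality of paths is [eq_paths]. *)

Section Euclidean.
Context {R : realType} {J : nat}.
Implicit Types x y : 'rV[R]_J.

Definition dotv x y : R := \sum_(i < J) x 0 i * y 0 i.

(* Euclidean norm; the library's `|x| on matrices is the max norm. *)
Definition enorm x : R := Num.sqrt (dotv x x).

Definition closed_convex_hull (A : set 'rV[R]_J) : set 'rV[R]_J :=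
  smallest [set C : set 'rV[R]_J | closed C /\ convex_set C] A.

End Euclidean.

Section Paths.
Context {R : realType} {J : nat}.
Implicit Types f g : R -> 'rV[R]_J.

Definition eq_paths f g := forall t : R, 0 <= t -> f t = g t.

Definition cadlag f :=
  (forall t : R, 0 <= t -> f x @[x --> t^'+] --> f t) /\
  (forall t : R, 0 < t -> cvg (f x @[x --> t^'-])).

Definition cadlag_from (G : set 'rV[R]_J) f := cadlag f /\ G (f 0).

(* f(t-), with the convention f(0-) = f(0). *)
Definition left_limit f (t : R) : 'rV[R]_J :=
  if 0 < t then lim (f x @[x --> t^'-]) else f 0.

Definition sup_enorm f (T : R) : \bar R :=
  ereal_sup [set (enorm (f t))%:E | t in `[0, T]].

End Paths.

Section ESP.
Context {R : realType} {J : nat}.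
Variables (G : set 'rV[R]_J) (d : 'rV[R]_J -> set 'rV[R]_J).
Implicit Types psi phi eta : R -> 'rV[R]_J.

(* In the condition on the increments of eta, s = t is left out: there the
   increment is 0 and the union is over the empty interval (t, t], so the
   condition is void under the usual convention that the hull of the empty set
   is {0} (whereas [closed_convex_hull set0] is empty). *)
Definition solves_ESP psi phi eta : Prop :=
  [/\ cadlag_from G phi, cadlag eta, phi 0 = psi 0 &
   forall t : R, 0 <= t ->
    [/\ phi t = psi t + eta t,
        G (phi t),
        forall s : R, 0 <= s < t ->
          closed_convex_hull (\bigcup_(u in `]s, t]) d (phi u))
                             (eta t - eta s) &
        closed_convex_hull (d (phi t)) (eta t - left_limit eta t)]].

(* The (a priori multivalued) extended Skorokhod map. *)
Definition ESM psi : set (R -> 'rV[R]_J) :=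
  [set phi | solves_ESP psi phi (fun t => phi t - psi t)].

Definition ESM_lipschitz : Prop :=
  exists l : R, forall T : R, 0 <= T ->
  forall psi1 psi2 phi1 phi2 : R -> 'rV[R]_J,
    cadlag_from G psi1 -> cadlag_from G psi2 ->
    ESM psi1 phi1 -> ESM psi2 phi2 ->
    (sup_enorm (fun t => (phi1 t - phi2 t)%R) T <=
     l%:E * sup_enorm (fun t => (psi1 t - psi2 t)%R) T)%E.

End ESP.

Section GPS.
Context {R : realType} {J : nat}.

Definition orthant : set 'rV[R]_J := [set x | forall i : 'I_J, 0 <= x 0 i].

Variable alpha : 'I_J -> R.

Definition gps_diag : 'rV[R]_J :=
  (Num.sqrt (J%:R : R))^-1 *: \sum_(i < J) delta_mx 0 i.

(* The J + 1 constraints are indexed by 'I_J.+1, with ord_max as the last one: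
   unlift ord_max i is Some j when i < J, where j has the same value as i, and
   None when i = ord_max. *)
Definition gps_normal (i : 'I_J.+1) : 'rV[R]_J :=
  if unlift ord_max i is Some j then delta_mx 0 j else gps_diag.

Definition gps_dir (i : 'I_J.+1) : 'rV[R]_J :=
  if unlift ord_max i is Some j then
    \row_k (if k == j then 1 else - (alpha k / (1 - alpha j)))
  else gps_diag.

Definition gps_d (x : 'rV[R]_J) : set 'rV[R]_J :=
  [set v | (interior orthant x /\ v = 0) \/
           ((closure orthant `\` interior orthant) x /\
            exists2 a : 'I_J.+1 -> R, (forall i, 0 <= a i) &
              v = \sum_(i < J.+1 | dotv x (gps_normal i) == 0)
                    a i *: gps_dir i)].

End GPS.

(* Main.v *)
Require Import Defs.
From mathcomp Require Import all_boot all_order all_algebra.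
From mathcomp Require Import all_classical all_reals all_analysis.
From mathcomp Require Import lra ring.

(** For a service class [k], the reflection direction d_k is a positive
    multiple of e_k - alpha, and at the origin the directions span the
    half-space of vectors with nonnegative coordinate sum, which is also
    generated by the e_k - alpha together with alpha itself. Hence the ratios
    w_k / alpha_k are the natural coordinates of a push w: the common part
    along alpha cancels in their differences, and pushing from the face k
    raises the k-th ratio relative to the others, which keep their differences.
    Equivalently, a push is allowed at x when the ratio of every class with x_i
    > 0 is minimal among all ratios, the total mass does not decrease, and it
    stays fixed unless x = 0. Being linear, these inequalities describe the
    closed convex hulls of the problem as well
    ([closed_convex_hull_admissible], [admissible_closed_convex_hull]), and the
    whole problem is about the pairs called [regulated] below.

    Let two regulated pairs have driving paths within D of each other, and let
    a be the difference of their pushing terms. The sum of a is of order D: if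
    it were larger, the first state would have positive mass, and a pair whose
    state is not at the origin gains no mass ([total_diff_le]). The oscillation
    max_k a_k / alpha_k - min_k a_k / alpha_k is also of order D: the weighted
    mean of these ratios is the sum of a, so a large oscillation makes a_i
    larger than D at the maximizer i and less than - D at the minimizer j. Then
    the first state is positive in coordinate i and the second one in
    coordinate j, and the inequalities for the two pairs show that a_i /
    alpha_i - a_j / alpha_j cannot grow ([share_diff_le]). Together these
    bounds give the Lipschitz estimate [regulated_lipschitz], and uniqueness.

    For existence, a piecewise constant path is handled jump by jump with a
    projection onto the orthant ([gps_projection]). Cadlag paths are uniform
    limits of such paths on compact sets, the Lipschitz estimate makes the
    solutions converge, and regulated pairs are closed under such limits
    ([regulated_closed]). *)

Set Implicit Arguments.
Unset Strict Implicit.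
Unset Printing Implicit Defensive.

Import Order.TTheory GRing.Theory Num.Theory.
Import numFieldNormedType.Exports.

Local Open Scope classical_set_scope.
Local Open Scope ring_scope.

(** * One-sided neighbourhoods and induction along an interval *)

Section OneSided.
Context {R : realType}.
Implicit Types (t : R) (P : R -> Prop).

Lemma near_rightP t P :
  (\forall v \near t^'+, P v) <->
  exists2 e, 0 < e & forall v, t < v < t + e -> P v.
Proof.
split=> [[e /= e0 H]|[e e0 H]]; last first.
  near=> v; apply: H; apply/andP; split; near: v.
    exact: nbhs_right_gt.
  by apply: nbhs_right_lt; rewrite ltrDl.
exists e => // v /andP[tv ve]; apply: H => //=.
by rewrite ltr_distlC; apply/andP; split; lra.
Unshelve. all: by end_near. Qed.

Lemma near_leftP t P :
  (\forall v \near t^'-, P v) <->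
  exists2 e, 0 < e & forall v, t - e < v < t -> P v.
Proof.
split=> [[e /= e0 H]|[e e0 H]]; last first.
  near=> v; apply: H; apply/andP; split; near: v.
    by apply: nbhs_left_gt; lra.
  exact: nbhs_left_lt.
exists e => // v /andP[tv ve]; apply: H => //=.
by rewrite ltr_distlC; apply/andP; split; lra.
Unshelve. all: by end_near. Qed.

(** No continuity of [Q] is needed: the infimum of the failures would contradict
    the right step if [Q] held there, and the left step otherwise. *)
Lemma real_induction (a b : R) (Q : R -> Prop) :
    Q a ->
    (forall u, a <= u < b -> Q u -> \forall v \near u^'+, v <= b -> Q v) ->
    (forall u, a < u <= b -> (forall s, a <= s < u -> Q s) -> Q u) ->
  forall u, a <= u <= b -> Q u.
Proof.
move=> Qa Qright Qleft.
suff all_below u : a <= u <= b -> forall s, a <= s <= u -> Q s.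
  by move=> u /[dup] /all_below + /andP[au _]; apply; rewrite au lexx.
move=> /andP[au ub] s0 /andP[as0 s0u]; apply: contrapT => nQ.
pose B := [set s | a <= s <= u /\ ~ Q s].
have B0 : B s0 by split => //; rewrite as0 s0u.
have lbB : lbound B a by move=> s [/andP[]].
have hB : has_inf B by split; [exists s0|exists a].
have aB : a <= inf B by apply: lb_le_inf => //; exists s0.
have Bs0 : inf B <= s0 by apply: ge_inf => //; exists a.
have below s : a <= s < inf B -> Q s.
  move=> /andP[as_ sB]; apply: contrapT => nQs.
  have : inf B <= s by apply: ge_inf; [exists a | split=> //; apply/andP; split=> //; lra].
  by rewrite leNgt sB.
have QB : Q (inf B).
  have [-> //|neq] := eqVneq (inf B) a.
  by apply: Qleft => //; rewrite lt_neqAle eq_sym neq aB /=; lra.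
have iB : inf B < b.
  have [//|bB] := ltP (inf B) b.
  exfalso; apply: nQ; have -> : s0 = inf B by apply/eqP; rewrite eq_le Bs0 andbT; lra.
  exact: QB.
have /near_rightP[e e0 He] := Qright _ (introT andP (conj aB iB)) QB.
have [s Bs se] := inf_adherent e0 hB.
have : inf B <= s by apply: ge_inf => //; exists a.
case: Bs => /andP[as_ su] nQs; rewrite le_eqVlt => /orP[/eqP Es|Bs].
  by apply: nQs; rewrite -Es.
by apply: nQs; apply: He; rewrite ?Bs ?se //; lra.
Qed.

End OneSided.

(** * Norms and convex hulls *)

Section MaxNorm.
Context {R : realType} {J : nat}.
Implicit Types x : 'rV[R]_J.

Lemma coord_le_norm x i : `|x 0 i| <= `|x|.
Proof.
rewrite [leRHS]/Num.Def.normr /= mx_normrE; apply/bigmax_geP; right => /=.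
by exists (ord0, i).
Qed.

Lemma norm_le_coord x (M : R) : 0 <= M -> (forall i, `|x 0 i| <= M) -> `|x| <= M.
Proof.
move=> M0 H; rewrite [leLHS]/Num.Def.normr /= mx_normrE; apply/bigmax_leP; split=> //.
by move=> [i j] _ /=; rewrite ord1.
Qed.

Lemma norm_le_enorm x : `|x| <= enorm x.
Proof.
apply: norm_le_coord => [|i]; first exact: sqrtr_ge0.
rewrite -sqrtr_sqr ler_sqrt; last by apply: sumr_ge0 => j _; rewrite -expr2 sqr_ge0.
rewrite /dotv (bigD1 i) //= expr2 lerDl.
by apply: sumr_ge0 => j _; rewrite -expr2 sqr_ge0.
Qed.

Lemma enorm_le_norm x : enorm x <= J%:R * `|x|.
Proof.
have nx : 0 <= J%:R * `|x| by rewrite mulr_ge0.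
rewrite -(ger0_norm nx) -sqrtr_sqr ler_sqrt ?sqr_ge0 //.
apply: (@le_trans _ _ (\sum_(i < J) `|x| ^+ 2)).
  apply: ler_sum => i _; rewrite -expr2 -real_normK ?num_real //.
  by rewrite lerXn2r ?nnegrE // coord_le_norm.
rewrite sumr_const card_ord exprMn -[leLHS]mulr_natl.
apply: ler_wpM2r; rewrite ?sqr_ge0 // -natrX ler_nat.
by case: (J) => // n; rewrite -mulnn leq_pmulr.
Qed.

End MaxNorm.

Section ConvexHull.
Context {R : realType} {J : nat}.
Implicit Types (A C : set 'rV[R]_J) (w : 'rV[R]_J).
Local Open Scope convex_scope.

Lemma closed_convex_hull_min A C :
  closed C -> convex_set C -> A `<=` C -> closed_convex_hull A `<=` C.
Proof. by move=> cC vC; apply: smallest_sub. Qed.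

Lemma midpoint_convex_set C x y :
  convex_set C -> C x -> C y -> C (2^-1 *: (x + y)).
Proof.
move=> vC Cx Cy.
have h0 : 0 <= 2^-1 :> R by rewrite invr_ge0.
have h1 : 2^-1 <= 1 :> R by rewrite invf_le1 ?ler1n.
have /set_mem := vC x y (Itv01 h0 h1) (mem_set Cx) (mem_set Cy).
congr (C _); rewrite scalerDr; congr (_ *: _ + _ *: _).
by rewrite /unstable.onem /=; lra.
Qed.

(** Splitting off one term at a time as a midpoint, the doubling that this
    costs is absorbed because every term may be rescaled. *)
Lemma closed_convex_hull_sum A (I : Type) (s : seq I) (w : I -> 'rV[R]_J) :
    A 0 -> (forall l (c : R), 0 <= c -> A (c *: w l)) ->
  closed_convex_hull A (\sum_(l <- s) w l).
Proof.
move=> A0 Aw C [[cC vC] AC].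
elim: s w Aw => [|l s IHs] w Aw; first by rewrite big_nil; exact: AC.
have half (v : 'rV[R]_J) : 2^-1 *: (2 *: v) = v.
  by rewrite scalerA mulVf ?scale1r // pnatr_eq0.
rewrite big_cons -[X in C X]half scalerDr; apply: midpoint_convex_set => //.
  exact/AC/Aw.
rewrite scaler_sumr; apply: IHs => m c c0; rewrite scalerA; apply: Aw.
by rewrite mulr_ge0.
Qed.

Lemma lipschitz_continuous (f : 'rV[R]_J -> R) (K : R) :
  (forall x y, `|f x - f y| <= K * `|x - y|) -> continuous f.
Proof.
move=> fK x; have FF : Filter (nbhs x) := nbhs_filter x.
apply/(@cvgrPdist_le _ _ _ (nbhs x) FF) => e e0; near=> y.
apply: (le_trans (fK x y)).
have K1 : 0 < `|K| + 1 by rewrite ltr_wpDl.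
apply: (@le_trans _ _ ((`|K| + 1) * `|x - y|)).
  by rewrite ler_wpM2r // (le_trans (ler_norm K)) // lerDl.
rewrite -ler_pdivlMl // mulrC; near: y.
apply: (@cvgr_dist_le R 'rV[R]_J _ (nbhs x) _ id x (@cvg_id _ _)).
by rewrite divr_gt0.
Unshelve. all: by end_near. Qed.

End ConvexHull.

(** * The cones of reflection directions *)

Section GPS.
Context {R : realType} {J : nat} (alpha : 'I_J -> R).
Context (J_ge2 : (2 <= J)%N) (alpha_gt0 : forall i, 0 < alpha i)
  (alpha_sum1 : \sum_(i < J) alpha i = 1).
Implicit Types x y w : 'rV[R]_J.

Definition total x : R := \sum_(i < J) x 0 i.

Lemma totalD x y : total (x + y) = total x + total y.
Proof. by rewrite -big_split; apply: eq_bigr => i _; rewrite mxE. Qed.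

Lemma totalZ c x : total (c *: x) = c * total x.
Proof. by rewrite mulr_sumr; apply: eq_bigr => i _; rewrite mxE. Qed.

Lemma totalB x y : total (x - y) = total x - total y.
Proof. by rewrite totalD -scaleN1r totalZ mulN1r. Qed.

Lemma total_le_norm x : `|total x| <= J%:R * `|x|.
Proof.
apply: (le_trans (ler_norm_sum _ _ _)).
rewrite mulr_natl -[X in _ *+ X]card_ord -sumr_const.
by apply: ler_sum => i _; exact: coord_le_norm.
Qed.

Lemma orthant_coord_le_total x i : orthant x -> x 0 i <= total x.
Proof. by move=> x0; rewrite /total (bigD1 i) //= lerDl sumr_ge0. Qed.

(** The linear inequalities that define the cones: as long as [gauge c] of the
    state is positive, and [c] is then called active, a push [w] must satisfy
    [force c w <= 0].  [Share i k] says that a class off its face has the smallest relative push, [Mass] that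
    no mass is lost, [Idle] that mass enters only at the origin. *)
Variant constraint := Share of 'I_J & 'I_J | Mass | Idle.

Definition gauge (c : constraint) x : R :=
  match c with Share i _ => x 0 i | Mass => 1 | Idle => total x end.

Definition force (c : constraint) w : R :=
  match c with
  | Share i k => w 0 i / alpha i - w 0 k / alpha k
  | Mass => - total w
  | Idle => total w
  end.

Lemma forceD c x y : force c (x + y) = force c x + force c y.
Proof. by case: c => [i k||] /=; rewrite ?totalD ?mxE; lra. Qed.

Lemma forceZ c r x : force c (r *: x) = r * force c x.
Proof. by case: c => [i k||] /=; rewrite ?totalZ ?mxE; lra. Qed.

Lemma force0 c : force c 0 = 0.
Proof. by rewrite -(scale0r 0) forceZ mul0r. Qed.

Lemma forceB c x y : force c (x - y) = force c x - force c y.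
Proof. by rewrite forceD -scaleN1r forceZ mulN1r. Qed.

Lemma force_sum c (I : Type) (s : seq I) (P : pred I) (w : I -> 'rV[R]_J) :
  force c (\sum_(l <- s | P l) w l) = \sum_(l <- s | P l) force c (w l).
Proof.
elim/big_rec2: _ => [|l x y _ <-]; last by rewrite forceD.
by rewrite force0.
Qed.

Definition inv_weights : R := \sum_(i < J) (alpha i)^-1.

Lemma inv_weight_le i : (alpha i)^-1 <= inv_weights.
Proof.
rewrite /inv_weights (bigD1 i) //= lerDl sumr_ge0 // => j _.
by rewrite invr_ge0 ltW.
Qed.

Lemma inv_weights_ge0 : 0 <= inv_weights.
Proof. by apply: sumr_ge0 => i _; rewrite invr_ge0 ltW. Qed.

Definition constraint_bound : R := J%:R + 2 * inv_weights.

Lemma constraint_bound_gt0 : 0 < constraint_bound.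
Proof.
have J0 : 0 < J%:R :> R by rewrite ltr0n (ltnW J_ge2).
by have := inv_weights_ge0; rewrite /constraint_bound; lra.
Qed.

Lemma force_le c w : `|force c w| <= constraint_bound * `|w|.
Proof.
have A0 := inv_weights_ge0; have N0 := normr_ge0 w.
have tot : `|total w| <= constraint_bound * `|w|.
  by apply: (le_trans (total_le_norm w)); rewrite ler_wpM2r // /constraint_bound; lra.
case: c => [i k||] /=; rewrite ?normrN //.
have ratio l : `|w 0 l / alpha l| <= inv_weights * `|w|.
  have a0 : 0 <= (alpha l)^-1 by rewrite invr_ge0 ltW.
  rewrite normrM (ger0_norm a0) mulrC.
  by apply: ler_pM => //; [exact: inv_weight_le | exact: coord_le_norm].
apply: (le_trans (ler_normB _ _)).
have := ratio i; have := ratio k; rewrite /constraint_bound.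
have : 0 <= J%:R * `|w| by rewrite mulr_ge0.
by rewrite mulrDl; lra.
Qed.

Lemma gauge_lipschitz c x y : `|gauge c x - gauge c y| <= constraint_bound * `|x - y|.
Proof.
have A0 := inv_weights_ge0; have N0 := normr_ge0 (x - y).
have J1 : 1 <= J%:R :> R by rewrite ler1n (ltnW J_ge2).
case: c => [i k||] /=.
- have -> : x 0 i - y 0 i = (x - y) 0 i by rewrite !mxE.
  apply: (le_trans (coord_le_norm _ _)).
  by rewrite ler_peMl // /constraint_bound; lra.
- by rewrite subrr normr0 mulr_ge0 // ltW // constraint_bound_gt0.
- rewrite -totalB; apply: (le_trans (total_le_norm _)).
  by rewrite ler_wpM2r // /constraint_bound; lra.
Qed.

Lemma alpha_lt1 i : alpha i < 1.
Proof.
have [j ji] : exists j : 'I_J, j != i.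
  case: J J_ge2 i => [|[|n]] // _ i.
  have [->|] := eqVneq i ord0; first by exists ord_max.
  by move=> ?; exists ord0; rewrite eq_sym.
rewrite -alpha_sum1 (bigD1 i) //= (bigD1 j) //= ltrDl ltr_pwDl // sumr_ge0 //.
by move=> k _; exact: ltW.
Qed.

(** The entry 1 at [k] is (1 - alpha k) / (1 - alpha k), so that all entries
    share the summand - alpha / (1 - alpha k). *)
Lemma gps_dir_lift k :
  gps_dir alpha (lift ord_max k) =
  (1 - alpha k)^-1 *: (delta_mx 0 k - \row_l alpha l).
Proof.
have ak := alpha_lt1 k; have a1 : 1 - alpha k != 0 by rewrite gt_eqF // subr_gt0.
rewrite /gps_dir liftK; apply/rowP => l; rewrite !mxE eqxx /=.
have [->|_] := eqVneq; first by rewrite mulVf.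
by rewrite sub0r mulrN mulrC.
Qed.

Lemma gps_dir_max : gps_dir alpha ord_max = \row_l (Num.sqrt J%:R)^-1 :> 'rV[R]_J.
Proof.
rewrite /gps_dir unlift_none /gps_diag; apply/rowP => l.
rewrite !mxE summxE (bigD1 l) //= big1 => [|m ml]; rewrite !mxE ?eqxx /=.
  by rewrite addr0 mulr1.
by rewrite eq_sym (negbTE ml).
Qed.

Lemma dotv_normal_lift x k : dotv x (gps_normal (lift ord_max k)) = x 0 k.
Proof.
rewrite /dotv /gps_normal liftK (bigD1 k) //= big1 => [|m mk]; rewrite !mxE ?eqxx /=.
  by rewrite addr0 mulr1.
by rewrite (negbTE mk) mulr0.
Qed.

Lemma sqrtJ_gt0 : 0 < Num.sqrt J%:R :> R.
Proof. by rewrite sqrtr_gt0 ltr0n (ltnW J_ge2). Qed.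

Lemma dotv_normal_max x : dotv x (gps_normal ord_max) = total x / Num.sqrt J%:R.
Proof.
rewrite /dotv /total mulr_suml; apply: eq_bigr => l _.
have := gps_dir_max; rewrite /gps_dir /gps_normal unlift_none => ->.
by rewrite mxE.
Qed.

Lemma force_dir_lift c k :
  force c (gps_dir alpha (lift ord_max k)) =
  match c with
  | Share i j => (1 - alpha k)^-1 * ((i == k)%:R / alpha i - (j == k)%:R / alpha j)
  | _ => 0
  end.
Proof.
have tot0 : total (delta_mx 0 k - \row_l alpha l) = 0.
  rewrite totalB /total (bigD1 k) //= big1 => [|m mk].
    rewrite mxE !eqxx addr0 -[X in X - _]alpha_sum1 -sumrB big1 // => l _.
    by rewrite mxE subrr.
  by rewrite mxE (negbTE mk).
rewrite gps_dir_lift forceZ; case: c => [i j||] /=; rewrite ?tot0 ?oppr0 ?mulr0 //.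
congr (_ * _); rewrite !mxE /= !mulrBl !divff ?(gt_eqF (alpha_gt0 _)) //.
by rewrite opprB addrA subrK.
Qed.

Lemma gps_d_force c x v :
  orthant x -> gps_d alpha x v -> 0 < gauge c x -> force c v <= 0.
Proof.
move=> Gx; case=> [[_ ->]|[_ [a a0 ->]]] cx.
  by rewrite force0.
rewrite force_sum; apply: sumr_le0 => l.
rewrite forceZ; case: (unliftP ord_max l) => [k|] ->.
  rewrite dotv_normal_lift => /eqP xk; apply: mulr_ge0_le0; first exact: a0.
  rewrite force_dir_lift; case: c cx => [i j||] //= xi.
  have -> : (i == k) = false by apply: contraTF xi => /eqP ->; rewrite xk ltxx.
  rewrite mul0r sub0r mulrN oppr_le0 mulr_ge0 ?invr_ge0 ?subr_ge0 ?(ltW (alpha_lt1 _)) //.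
  by rewrite mulr_ge0 // invr_ge0 ltW.
rewrite dotv_normal_max mulf_eq0 invr_eq0 (gt_eqF sqrtJ_gt0) orbF => /eqP x0.
apply: mulr_ge0_le0; first exact: a0.
have tot_dir : 0 <= total (gps_dir alpha ord_max).
  rewrite gps_dir_max; apply: sumr_ge0 => i _.
  by rewrite mxE invr_ge0 ltW // sqrtJ_gt0.
case: c cx => [i j||] /=; rewrite ?x0 ?ltxx ?oppr_le0 //.
by move=> xi; have := orthant_coord_le_total i Gx; rewrite x0 leNgt xi.
Qed.

Lemma interior_orthant_gt0 x i : interior orthant x -> 0 < x 0 i.
Proof.
move=> xo; have Gx : orthant x by exact: interior_subset.
rewrite lt_neqAle Gx andbT; apply/eqP => xi.
have /nbhs_ballP[e /= e0 He] := xo.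
have /He /(_ i) : ball x e (x - \row_k (e / 2)).
  rewrite -ball_normE /ball_ /= opprB addrCA subrr addr0.
  apply: (@le_lt_trans _ _ (e / 2)); last by rewrite ltr_pdivrMr // ltr_pMr // ltr1n.
  apply: norm_le_coord => [|k]; first by rewrite divr_ge0 // ltW.
  by rewrite mxE ger0_norm // divr_ge0 // ltW.
by rewrite !mxE -xi; lra.
Qed.

Lemma gps_d0 x : orthant x -> gps_d alpha x 0.
Proof.
move=> Gx; have [xo|xo] := pselect (interior orthant x); [by left|right].
split; first by split => //; exact: subset_closure.
by exists (fun=> 0) => //; rewrite big1 // => l _; rewrite scale0r.
Qed.

(** A state on the hyperplane of some normal is automatically on the boundary of
    the orthant: the last normal only vanishes at the origin. *)
Lemma gps_d_ray x l a :
  orthant x -> dotv x (gps_normal l) = 0 -> 0 <= a ->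
  gps_d alpha x (a *: gps_dir alpha l).
Proof.
move=> Gx xl a0; right; split.
  split; first exact: subset_closure.
  move=> xo; move: xl; case: (unliftP ord_max l) => [k|] ->.
    by rewrite dotv_normal_lift => xk; have := interior_orthant_gt0 k xo; rewrite xk ltxx.
  move=> /eqP; rewrite dotv_normal_max mulf_eq0 invr_eq0 (gt_eqF sqrtJ_gt0) orbF.
  have i : 'I_J := Ordinal (ltnW J_ge2).
  move=> /eqP x0; have := orthant_coord_le_total i Gx.
  by rewrite x0 leNgt interior_orthant_gt0.
exists (fun m => if m == l then a else 0) => [m|]; first by case: ifP.
rewrite (bigD1 l) ?xl //= eqxx big1 ?addr0 // => m /andP[_ /negbTE ->].
by rewrite scale0r.
Qed.

Definition admissible (phi : R -> 'rV[R]_J) (U : set R) w : Prop :=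
  forall c, (forall u, U u -> 0 < gauge c (phi u)) -> force c w <= 0.

(** Each constraint that is active on [U] is a closed half-space containing all
    the cones, hence their hull. *)
Lemma closed_convex_hull_admissible phi (U : set R) w :
    (forall u, U u -> orthant (phi u)) ->
    closed_convex_hull (\bigcup_(u in U) gps_d alpha (phi u)) w ->
  admissible phi U w.
Proof.
move=> GU Hw c cU.
suff /(_ w Hw) : closed_convex_hull (\bigcup_(u in U) gps_d alpha (phi u))
    `<=` [set v | force c v <= 0] by [].
apply: closed_convex_hull_min.
- have fc : continuous (force c).
    apply: (@lipschitz_continuous _ _ _ constraint_bound) => x y.
    by rewrite -forceB force_le.
  by apply: (@preimage_closed _ _ (force c) [set r | r <= 0]); [move=> ? _; exact: fc | exact: closed_le].
- move=> x y p /set_mem /= fx /set_mem /= fy; apply/mem_set.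
  rewrite /conv /= forceD !forceZ.
  by rewrite -[leRHS]addr0 lerD // mulr_ge0_le0 // unstable.onem_ge0.
- by move=> v [u Uu dv] /=; exact: gps_d_force (GU u Uu) dv (cU u Uu).
Qed.

(** The sum of [w] fixes the coefficient of the last direction.  The others are
    only determined up to the relation Sum_k alpha_k (e_k - alpha) = 0, and [m]
    is the resulting degree of freedom. *)
Lemma gps_cone_decomposition w m :
  let c k := w 0 k - total w / J%:R - alpha k * m in
  w = \sum_l (if unlift ord_max l is Some k then (1 - alpha k) * c k
               else total w / Num.sqrt J%:R) *: gps_dir alpha l.
Proof.
move=> c; rewrite big_ord_recr /= unlift_none.
under eq_bigr => k _.
  have -> : widen_ord (leqnSn J) k = lift ord_max k.
    by apply: ord_inj; rewrite lift_max.
  rewrite liftK gps_dir_lift scalerA mulrAC divff ?mul1r; last first.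
    by rewrite gt_eqF // subr_gt0 alpha_lt1.
  over.
have J0 : J%:R != 0 :> R by rewrite pnatr_eq0 -lt0n (ltnW J_ge2).
have sumc : \sum_k c k = - m.
  rewrite /c !sumrB -[X in _ - X]mulr_suml alpha_sum1 sumr_const card_ord -/(total w).
  by rewrite -(mulr_natr (_ / _)) divfK // subrr mul1r sub0r.
apply/rowP => j; rewrite gps_dir_max !mxE summxE (bigD1 j) //=.
under eq_bigr => k kj do rewrite !mxE eq_sym (negbTE kj) sub0r mulrN.
rewrite sumrN -mulr_suml !mxE eqxx /=.
move: sumc; rewrite (bigD1 j) //= => /(canRL (addKr _)) ->.
rewrite -mulrA -invfM -expr2 sqr_sqrtr // /c.
by rewrite eqxx /=; field.
Qed.

(** Decompose [w] along the directions, with the multiple of alpha chosen such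
    that the smallest coefficient is 0.  A direction whose face is never visited
    during [U] must then have coefficient 0, because of the constraint that is
    active for it; the other ones lie in a cone of the union. *)
Lemma admissible_closed_convex_hull phi (U : set R) w :
    U !=set0 -> (forall u, U u -> orthant (phi u)) ->
    admissible phi U w ->
  closed_convex_hull (\bigcup_(u in U) gps_d alpha (phi u)) w.
Proof.
move=> [u0 Uu0] GU adm.
have w0 : 0 <= total w by have /= := adm Mass (fun _ _ => ltr01); lra.
pose v k := w 0 k - total w / J%:R.
pose i0 : 'I_J := Ordinal (ltnW J_ge2).
(* subtracting alpha k times the smallest ratio makes all coefficients >= 0 *)
pose k0 := [arg min_(k < i0) (v k / alpha k)]%O.
have k0_min k : v k0 / alpha k0 <= v k / alpha k.
  by rewrite /k0; case: arg_minP => // j _; apply.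
rewrite (gps_cone_decomposition w (v k0 / alpha k0)).
have hull0 : (\bigcup_(u in U) gps_d alpha (phi u)) 0.
  by exists u0 => //; apply: gps_d0; exact: GU.
have Jgt0 : 0 < J%:R :> R by rewrite ltr0n (ltnW J_ge2).
apply: closed_convex_hull_sum => // l r r0; rewrite scalerA.
case: (unliftP ord_max l) => [k|] -> ; rewrite ?liftK ?unlift_none.
- set c := _ - _ - _ * _; have c0 : 0 <= c.
    rewrite /c -/(v k) subr_ge0 -ler_pdivlMl // [leRHS]mulrC; exact: k0_min.
  have [[u Uu xk]|noxk] := pselect (exists2 u, U u & phi u 0 k = 0).
    exists u => //; apply: gps_d_ray; [exact: GU | by rewrite dotv_normal_lift|].
    by rewrite !mulr_ge0 // subr_ge0 ltW // alpha_lt1.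
  suff -> : c = 0 by rewrite !mulr0 scale0r.
  have xk_gt0 u : U u -> 0 < phi u 0 k.
    by move=> Uu; rewrite lt_neqAle GU // andbT eq_sym; apply/eqP => xk; apply: noxk; exists u.
  have tw : total w = 0.
    apply/eqP; rewrite eq_le w0 andbT; apply: (adm Idle) => u Uu /=.
    by apply: (lt_le_trans (xk_gt0 u Uu)); apply: orthant_coord_le_total; exact: GU.
  have /= share := adm (Share k k0) xk_gt0.
  apply/eqP; rewrite eq_le c0 andbT /c /v tw mul0r !subr0 subr_le0.
  by rewrite -ler_pdivrMl // mulrC; lra.
- have [[u Uu xt]|noxt] := pselect (exists2 u, U u & total (phi u) = 0).
    exists u => //; apply: gps_d_ray; first exact: GU.
      by rewrite dotv_normal_max xt mul0r.
    by rewrite mulr_ge0 // divr_ge0 // ltW // sqrtJ_gt0.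
  suff -> : total w = 0 by rewrite mul0r mulr0 scale0r.
  apply/eqP; rewrite eq_le w0 andbT; apply: (adm Idle) => u Uu /=.
  rewrite lt_neqAle eq_sym sumr_ge0 ?andbT; last by move=> i _; exact: GU.
  by apply/eqP => xt; apply: noxt; exists u.
Qed.

(** * Regulated pairs *)

Implicit Types phi eta psi : R -> 'rV[R]_J.

Lemma force_cvg (F : set_system R) {FF : Filter F} c eta q :
  eta x @[x --> F] --> q -> force c (eta x) @[x --> F] --> force c q.
Proof.
move=> etaq; apply: continuous_cvg etaq.
apply: (@lipschitz_continuous _ _ _ constraint_bound) => x y.
by rewrite -forceB force_le.
Qed.

(** The extended Skorokhod problem for the driving path [phi - eta], with the
    hulls replaced by the linear constraints. *)
Record regulated phi eta : Prop := Regulated {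
  reg_orthant : forall t : R, 0 <= t -> orthant (phi t);
  reg_start : eta 0 = 0;
  reg_right : forall t : R, 0 <= t -> eta x @[x --> t^'+] --> eta t;
  reg_incr : forall s t : R, 0 <= s < t ->
    admissible phi `]s, t] (eta t - eta s);
  reg_jump : forall t : R, 0 < t -> exists2 q : 'rV[R]_J, eta x @[x --> t^'-] --> q &
    admissible phi [set t] (eta t - q) }.

(** The inequalities over a long interval are recovered by real induction from
    the behaviour just after each time and from the jumps.  This is the form in
    which they can be checked for step functions and for uniform limits. *)
Lemma regulated_local phi eta :
    (forall t : R, 0 <= t -> orthant (phi t)) ->
    eta 0 = 0 ->
    (forall t : R, 0 <= t -> eta x @[x --> t^'+] --> eta t) ->
    (forall (t : R) c, 0 <= t -> 0 < gauge c (phi t) ->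
      \forall v \near t^'+, force c (eta v) <= force c (eta t)) ->
    (forall t : R, 0 < t -> exists2 q : 'rV[R]_J, eta x @[x --> t^'-] --> q &
      admissible phi [set t] (eta t - q)) ->
  regulated phi eta.
Proof.
move=> G0 eta0 right_cont loc jump; split => // s t /andP[s0 st] c cpos.
rewrite forceB subr_le0.
have f_right : force c (eta x) @[x --> s^'+] --> force c (eta s).
  by apply: force_cvg; exact: right_cont.
apply: (cvgr_to_ge f_right); near=> r.
have sr : s < r by near: r; exact: nbhs_right_gt.
have rt : r <= t by near: r; exact: nbhs_right_le.
have pos u : r <= u <= t -> 0 < gauge c (phi u).
  by move=> /andP[ru ut]; apply: cpos; rewrite /= in_itv /= ut andbT (lt_le_trans sr).
apply: (real_induction (a := r) (b := t)
  (Q := fun u => force c (eta u) <= force c (eta r))).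
- exact: lexx.
- move=> u /andP[ru ut] fu; near=> v => vt; apply: le_trans fu; near: v.
  by apply: loc; [lra | apply: pos; rewrite ru ltW].
- move=> u /andP[ru ut] fbelow.
  have u0 : 0 < u by lra.
  have [q etaq adm] := jump u u0.
  have fq : force c (eta u) <= force c q.
    rewrite -subr_le0 -forceB; apply: adm => _ ->.
    by apply: pos; rewrite (ltW ru) ut.
  apply: (le_trans fq).
  have f_left : force c (eta x) @[x --> u^'-] --> force c q by exact: force_cvg.
  apply: (cvgr_to_le f_left).
  near=> v; apply: fbelow; apply/andP; split; near: v; last exact: nbhs_left_lt.
  exact: nbhs_left_ge.
- by rewrite rt lexx.
Unshelve. all: by end_near. Qed.

(** * The Lipschitz estimate *)

(** If [c] is active for one pair and [dual c] for another, [force c] of the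
    difference of their pushes cannot increase. *)
Definition dual (c : constraint) : constraint :=
  match c with Share i k => Share k i | Mass => Idle | Idle => Mass end.

Lemma force_dual c w : force (dual c) w = - force c w.
Proof. by case: c => [i k||] /=; rewrite ?opprK // opprB. Qed.

Section Comparison.
Context {phi1 eta1 phi2 eta2 : R -> 'rV[R]_J}.
Context (reg1 : regulated phi1 eta1) (reg2 : regulated phi2 eta2).

Lemma compare_incr c (s t : R) : 0 <= s < t ->
    (forall u : R, s < u <= t -> 0 < gauge c (phi1 u) /\ 0 < gauge (dual c) (phi2 u)) ->
  force c (eta1 t - eta2 t) <= force c (eta1 s - eta2 s).
Proof.
move=> st pos.
have h1 : force c (eta1 t - eta1 s) <= 0.
  by apply: (reg_incr reg1 st) => u; rewrite /= in_itv => /pos[].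
have h2 : force (dual c) (eta2 t - eta2 s) <= 0.
  by apply: (reg_incr reg2 st) => u; rewrite /= in_itv => /pos[].
by move: h1 h2; rewrite force_dual !forceB; lra.
Qed.

Lemma compare_jump c (u K : R) : 0 < u ->
    0 < gauge c (phi1 u) -> 0 < gauge (dual c) (phi2 u) ->
    (forall s : R, 0 <= s < u -> force c (eta1 s - eta2 s) <= K) ->
  force c (eta1 u - eta2 u) <= K.
Proof.
move=> u0 pos1 pos2 below.
have [q1 eta1q adm1] := reg_jump reg1 u0; have [q2 eta2q adm2] := reg_jump reg2 u0.
have h1 : force c (eta1 u - q1) <= 0 by apply: adm1 => _ ->.
have h2 : force (dual c) (eta2 u - q2) <= 0 by apply: adm2 => _ ->.
suff : force c (q1 - q2) <= K by move: h1 h2; rewrite force_dual !forceB; lra.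
have lim12 : force c (eta1 x - eta2 x) @[x --> u^'-] --> force c (q1 - q2).
  by apply: force_cvg; exact: cvgB.
apply: (cvgr_to_le lim12); near=> s; apply: below; apply/andP; split; near: s.
  exact: nbhs_left_ge.
exact: nbhs_left_lt.
Unshelve. all: by end_near. Qed.

(** Suppose that every excess over the level [K] at a time [v] is witnessed by a
    constraint that is active as long as the difference of the pushes is
    [mu]-close to its value at [v].  By right continuity at an earlier time [u],
    that closeness holds on the whole of ]u, v] when [v] is near [u]; so the
    same constraint was already in excess at [u], and the level is never
    crossed. *)
Lemma barrier (X : constraint -> Prop) (K mu T : R) : 0 <= K -> 0 < mu ->
    (forall (v : R) c0, 0 <= v <= T -> X c0 -> K < force c0 (eta1 v - eta2 v) ->
      exists c, [/\ X c, K < force c (eta1 v - eta2 v) &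
        forall w : R, 0 <= w <= T ->
          `|(eta1 w - eta2 w) - (eta1 v - eta2 v)| <= mu ->
          0 < gauge c (phi1 w) /\ 0 < gauge (dual c) (phi2 w)]) ->
  forall c (t : R), X c -> 0 <= t <= T -> force c (eta1 t - eta2 t) <= K.
Proof.
move=> K0 mu0 active c t Xc tT; move: (c) Xc.
pose Q (u : R) := forall c, X c -> force c (eta1 u - eta2 u) <= K.
apply: (real_induction (a := 0) (b := T) (Q := Q)) => //.
- move=> {}c _; rewrite (reg_start reg1) (reg_start reg2) subrr.
  by rewrite force0.
- move=> u /andP[u0 uT] Qu.
  have cont : eta1 x - eta2 x @[x --> u^'+] --> eta1 u - eta2 u.
    by apply: cvgB; [exact: reg_right reg1 _ u0 | exact: reg_right reg2 _ u0].
  have mu2 : 0 < mu / 2 by rewrite divr_gt0.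
  move/cvgrPdist_le: cont => /(_ _ mu2) /near_rightP[e e0 He].
  apply/near_rightP; exists e => // v uv vT c0 Xc0.
  rewrite leNgt; apply/negP => Kc0.
  have v0 : 0 <= v <= T by rewrite vT andbT; lra.
  have [c' [Xc' Kc' pos]] := active v c0 v0 Xc0 Kc0.
  have /compare_incr : 0 <= u < v by rewrite u0; lra.
  move=> /(_ c'); have := Qu c' Xc'.
  suff pos' (w : R) : u < w <= v -> 0 < gauge c' (phi1 w) /\ 0 < gauge (dual c') (phi2 w).
    by move=> + /(_ pos'); lra.
  move=> /andP[uw wv]; apply: pos; first by apply/andP; split; lra.
  rewrite distrC; set a := eta1 u - eta2 u in He.
  have Hv := He v uv; have Hw : `|a - (eta1 w - eta2 w)| <= mu / 2.
    by apply: He; apply/andP; split; lra.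
  have sub_sub (x y z : 'rV[R]_J) : x - y - (x - z) = z - y.
    by rewrite [- (x - z)]opprB addrC subrKA.
  rewrite -(sub_sub a (eta1 w - eta2 w)).
  by apply: (le_trans (ler_normB _ _)); rewrite (splitr mu) lerD.
- move=> u /andP[u0 uT] below c0 Xc0.
  rewrite leNgt; apply/negP => Kc0.
  have u0T : 0 <= u <= T by rewrite ltW.
  have [c' [Xc' Kc' /(_ u u0T) pos]] := active u c0 u0T Xc0 Kc0.
  have [|pos1 pos2] := pos; first by rewrite subrr normr0 ltW.
  have := compare_jump u0 pos1 pos2 (fun s su => below s su c' Xc'); lra.
Qed.

End Comparison.

(** [total x] is the mean of the ratios [x 0 k / alpha k] with weights [alpha k],
    so a low ratio at [j] keeps it below the largest ratio by at least
    [alpha j] times the gap. *)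
Lemma weighted_sum_bound x i j :
    (forall k, x 0 k / alpha k <= x 0 i / alpha i) ->
  total x + alpha j * (x 0 i / alpha i - x 0 j / alpha j) <= x 0 i / alpha i.
Proof.
move: (x 0 i / alpha i) => m max_m.
have gap0 k : 0 <= alpha k * (m - x 0 k / alpha k).
  by rewrite mulr_ge0 ?subr_ge0 // ltW.
have mE : m = total x + \sum_k alpha k * (m - x 0 k / alpha k).
  rewrite -[LHS]mul1r -alpha_sum1 mulr_suml -big_split; apply: eq_bigr => k _.
  by rewrite /= mulrBr [alpha k * (_ / _)]mulrCA divff ?mulr1 ?gt_eqF // addrC subrK.
rewrite [leRHS]mE lerD2l (bigD1 j) //= lerDl.
by apply: sumr_ge0.
Qed.

Section Estimate.
Context {phi1 eta1 phi2 eta2 : R -> 'rV[R]_J} {D T : R}.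
Context (reg1 : regulated phi1 eta1) (reg2 : regulated phi2 eta2).
Context (D_gt0 : 0 < D)
  (diffD : forall t : R, 0 <= t <= T ->
     `|(phi1 t - eta1 t) - (phi2 t - eta2 t)| <= D).

(** Once the first pair has received more than [J * D] extra mass, the total of
    its state exceeds that of the other state, which is nonnegative; its state
    is thus not the origin and it receives nothing more.  The factor 2 leaves
    room for the closeness in [barrier]. *)
Lemma total_diff_le t : 0 <= t <= T -> total (eta1 t - eta2 t) <= 2 * J%:R * D.
Proof.
have J0 : 0 < J%:R :> R by rewrite ltr0n (ltnW J_ge2).
move=> tT; apply: (barrier reg1 reg2 (X := eq Idle) (mu := D) (T := T) (c := Idle) _ D_gt0 _ erefl tT).
  by rewrite !mulr_ge0 // ltW.
move=> v c v0 <- /= Sv; exists Idle; split => // w w0 wv /=; split => //.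
have := le_trans (total_le_norm _) (ler_wpM2l (ltW J0) wv).
have := le_trans (total_le_norm _) (ler_wpM2l (ltW J0) (diffD w0)).
have : 0 <= total (phi2 w) by apply: sumr_ge0 => i _; apply: (reg_orthant reg2); case/andP: w0.
move: Sv; rewrite !ler_norml !totalB.
have : 0 < J%:R * D by rewrite mulr_gt0.
rewrite -mulrA; lra.
Qed.

End Estimate.

(** The size of oscillation, relative to [D], that forces the extreme entries of
    a vector with sum at most [2 * J * D] beyond [2 * D] in absolute value. *)
Definition osc_factor : R := (2 * inv_weights + 2 * J%:R) * inv_weights.

Lemma total_diff_abs (phi1 eta1 phi2 eta2 : R -> 'rV[R]_J) (D T : R) :
    regulated phi1 eta1 -> regulated phi2 eta2 -> 0 < D ->
    (forall t : R, 0 <= t <= T ->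
       `|(phi1 t - eta1 t) - (phi2 t - eta2 t)| <= D) ->
  forall t : R, 0 <= t <= T -> `|total (eta1 t - eta2 t)| <= 2 * J%:R * D.
Proof.
move=> reg1 reg2 D0 diffD t tT; rewrite ler_norml -lerN2 opprK.
rewrite (total_diff_le reg1 reg2 D0 diffD tT) andbT totalB opprB -totalB.
by apply: (total_diff_le reg2 reg1 D0 _ tT) => s /diffD; rewrite distrC.
Qed.

(** Applied to the pair of classes where the ratio [a 0 k / alpha k] is largest
    and smallest: [a 0 i > 2 * D] keeps the first state off the face [i] and
    [a 0 j < - (2 * D)] keeps the second one off the face [j], which makes
    [Share i j] and its dual active. *)
Lemma share_diff_le (phi1 eta1 phi2 eta2 : R -> 'rV[R]_J) (D T : R) :
    regulated phi1 eta1 -> regulated phi2 eta2 -> 0 < D ->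
    (forall t : R, 0 <= t <= T ->
       `|(phi1 t - eta1 t) - (phi2 t - eta2 t)| <= D) ->
  forall (t : R) i j, 0 <= t <= T ->
    force (Share i j) (eta1 t - eta2 t) <= osc_factor * D.
Proof.
move=> reg1 reg2 D0 diffD t i j tT.
have A0 := inv_weights_ge0.
have osc0 : 0 <= osc_factor * D by rewrite !mulr_ge0 ?addr_ge0 ?mulr_ge0 // ltW.
pose X c := exists i j, c = Share i j.
apply: (barrier reg1 reg2 (X := X) (mu := D) (T := T) osc0 D0 _ _ tT); last by exists i, j.
move=> {tT t i j} v _ vT [i0 [j0 ->]] far.
pose a := eta1 v - eta2 v; pose b k := a 0 k / alpha k.
(* only an extremal pair is known to have both entries far from 0 *)
pose i := [arg max_(k > i0) b k]%O; pose j := [arg min_(k < j0) b k]%O.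
have i_max k : b k <= b i by rewrite /i; case: arg_maxP => // ? _; apply.
have j_min k : b j <= b k by rewrite /j; case: arg_minP => // ? _; apply.
have far_ij : osc_factor * D < b i - b j.
  apply: (lt_le_trans far); rewrite /= -/a -/(b i0) -/(b j0).
  by have := i_max i0; have := j_min j0; lra.
exists (Share i j); split => //; first by exists i, j.
have far_scaled k : 2 * inv_weights * D + 2 * J%:R * D < alpha k * (b i - b j).
  apply: (@le_lt_trans _ _ (alpha k * (osc_factor * D))); last by rewrite ltr_pM2l.
  have -> : alpha k * (osc_factor * D) =
      (alpha k * inv_weights) * (2 * inv_weights * D + 2 * J%:R * D).
    by rewrite /osc_factor; ring.
  rewrite ler_peMl //; first by rewrite addr_ge0 // !mulr_ge0 // ltW.
  by rewrite -ler_pdivrMl // mulr1; exact: inv_weight_le.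
have ratio_le k (y : R) : 0 <= y -> y / alpha k <= inv_weights * y.
  by move=> y0; rewrite mulrC ler_wpM2r // inv_weight_le.
have D2 : 0 <= 2 * D by rewrite mulr_ge0 // ltW.
have /ler_normlP[tot_lo tot_hi] := total_diff_abs reg1 reg2 D0 diffD vT.
have a_i : 2 * D < a 0 i.
  rewrite ltNge; apply/negP => small.
  have bi : b i <= inv_weights * (2 * D).
    by apply: le_trans (ratio_le i _ D2); rewrite ler_wpM2r // invr_ge0 ltW.
  have := @weighted_sum_bound a i j i_max.
  by have := far_scaled j; rewrite -/(b i) -/(b j); move: tot_lo tot_hi; rewrite -/a; lra.
have a_j : a 0 j < - (2 * D).
  rewrite ltNge; apply/negP => small.
  have bj : - b j <= inv_weights * (2 * D).
    apply: le_trans (ratio_le j _ D2); rewrite -mulNr ler_wpM2r ?invr_ge0 ?(ltW (alpha_gt0 _)) //.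
    by rewrite lerNl.
  have bN k : (- a) 0 k / alpha k = - b k by rewrite mxE mulNr.
  have Nj_max k : (- a) 0 k / alpha k <= (- a) 0 j / alpha j by rewrite !bN lerN2.
  have := weighted_sum_bound i Nj_max; rewrite !bN.
  have -> : total (- a) = - total a by rewrite -[- a]scaleN1r totalZ mulN1r.
  by have := far_scaled i; move: tot_lo tot_hi; rewrite -/a; lra.
move=> w w0 wv.
have coord k := le_trans (coord_le_norm _ k) wv.
have psi k := le_trans (coord_le_norm _ k) (diffD w w0).
have w00 : 0 <= w by case/andP: w0.
split => /=.
- have := reg_orthant reg2 w00 i; have := coord i; have := psi i.
  by move: a_i; rewrite /a !mxE !ler_norml; lra.
- have := reg_orthant reg1 w00 j; have := coord j; have := psi j.
  by move: a_j; rewrite /a !mxE !ler_norml; lra.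
Qed.

Definition lipschitz_factor : R := osc_factor + 2 * J%:R.

(** Every ratio is within the oscillation of the weighted mean of the ratios,
    which is the sum already estimated. *)
Lemma regulated_lipschitz (phi1 eta1 phi2 eta2 : R -> 'rV[R]_J) (D T : R) :
    regulated phi1 eta1 -> regulated phi2 eta2 -> 0 < D ->
    (forall t : R, 0 <= t <= T ->
       `|(phi1 t - eta1 t) - (phi2 t - eta2 t)| <= D) ->
  forall t : R, 0 <= t <= T -> `|eta1 t - eta2 t| <= lipschitz_factor * D.
Proof.
move=> reg1 reg2 D0 diffD t tT; set a := eta1 t - eta2 t.
have osc i j := share_diff_le reg1 reg2 D0 diffD i j tT.
have tot := total_diff_abs reg1 reg2 D0 diffD tT.
have osc0 : 0 <= osc_factor * D.
  have i : 'I_J := Ordinal (ltnW J_ge2).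
  by have := osc i i; rewrite /= subrr.
apply: norm_le_coord => [|k].
  by rewrite mulrDl addr_ge0 // !mulr_ge0 // ltW.
have mean : a 0 k / alpha k - total a = \sum_l alpha l * (a 0 k / alpha k - a 0 l / alpha l).
  rewrite -[X in X - _]mul1r -alpha_sum1 mulr_suml -sumrB; apply: eq_bigr => l _.
  by rewrite mulrBr [alpha l * (a 0 l / _)]mulrCA divff ?mulr1 // gt_eqF.
have dev : `|a 0 k / alpha k - total a| <= osc_factor * D.
  rewrite mean; apply: (le_trans (ler_norm_sum _ _ _)).
  rewrite -[leRHS]mul1r -alpha_sum1 mulr_suml; apply: ler_sum => l _.
  rewrite normrM gtr0_norm // ler_pM2l // ler_norml lerNl opprB.
  by rewrite (osc k l) (osc l k).
have -> : a 0 k = alpha k * (a 0 k / alpha k) by rewrite mulrCA divff ?mulr1 // gt_eqF.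
rewrite normrM gtr0_norm //.
apply: (@le_trans _ _ `|a 0 k / alpha k|).
  by rewrite ler_piMl // ltW // alpha_lt1.
rewrite -[X in `|X|](subrK (total a)) mulrDl.
by apply: (le_trans (ler_normD _ _)); rewrite lerD.
Qed.

(** * Uniform limits of regulated pairs and existence *)

(** If [x] has no mass, the origin absorbs it.  Otherwise all classes are lowered
    by [C] times their weight and truncated at 0; for a
    suitable [C], which exists by the intermediate value theorem, the mass added
    by truncating equals the mass removed by lowering. *)
Lemma gps_projection x :
  exists y w, [/\ orthant y, y = x + w & forall c, 0 < gauge c y -> force c w <= 0].
Proof.
have [tx|tx] := leP (total x) 0.
  exists 0, (- x); split; [by move=> i; rewrite mxE | by rewrite subrr |].
  have tot0 : total (0 : 'rV[R]_J) = 0 by rewrite -(subrr 0) totalB subrr.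
  have totN : total (- x) = - total x by rewrite -[- x]sub0r totalB tot0 sub0r.
  by case=> [i k||] /=; rewrite ?tot0 ?mxE ?ltxx // totN opprK.
pose y C i := Num.max (x 0 i - alpha i * C) 0.
pose B := inv_weights * `|x|.
have B0 : 0 <= B by rewrite mulr_ge0 // inv_weights_ge0.
have yB i : y B i = 0.
  apply/max_idPr; rewrite subr_le0 /B mulrA.
  apply: (le_trans (ler_norm _)); apply: (le_trans (coord_le_norm x i)).
  rewrite ler_peMl // -ler_pdivrMl // mulr1; exact: inv_weight_le.
have cont : {within `[0, B], continuous (fun C => \sum_i y C i)}.
  apply: continuous_subspaceT; apply: continuous_big => [|i _ C].
    by move=> p; exact: add_continuous.
  apply: (@continuous_max R _ (fun C => x 0 i - alpha i * C) (cst 0)); last exact: cst_continuous.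
  apply: continuousB; first exact: cst_continuous.
  apply: continuousM; first exact: cst_continuous.
  exact: cvg_id.
have [|C] := IVT (v := total x) B0 cont.
  have -> : \sum_i y B i = 0 by rewrite big1.
  have x_le_y0 : total x <= \sum_i y 0 i.
    by apply: ler_sum => i _; rewrite /y mulr0 subr0 le_max lexx.
  by rewrite ge_min le_max (ltW tx) x_le_y0 orbT.
rewrite in_itv /= => /andP[C0 _] sumC.
exists (\row_i y C i), (\row_i y C i - x); split.
- by move=> i; rewrite mxE le_max lexx orbT.
- by rewrite addrC subrK.
- have tot : total (\row_i y C i - x) = 0.
    rewrite totalB -sumC; apply/eqP; rewrite subr_eq0; apply/eqP.
    by apply: eq_bigr => i _; rewrite mxE.
  case=> [i k||] /=; rewrite ?tot ?oppr0 // !mxE => yi.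
  have low l : - C <= (y C l - x 0 l) / alpha l.
    rewrite ler_pdivlMr // lerBrDr mulNr mulrC addrC /y.
    by rewrite le_max lexx.
  have := low k; suff -> : (y C i - x 0 i) / alpha i = - C by lra.
  have -> : y C i = x 0 i - alpha i * C.
    by move: yi; rewrite /y lt_max ltxx orbF => /ltW /max_idPl.
  by rewrite addrAC subrr sub0r mulNr mulrAC divff ?mul1r // gt_eqF.
Qed.

Lemma small_radius (g e : R) : 0 < g -> 0 < e ->
  exists r, [/\ 0 < r, constraint_bound * r <= g & constraint_bound * r <= e].
Proof.
move=> g0 e0; exists (Num.min g e / constraint_bound).
rewrite mulrCA divff ?mulr1 ?gt_eqF ?constraint_bound_gt0 //.
by split; rewrite ?ge_min ?lexx ?orbT // divr_gt0 ?constraint_bound_gt0 // lt_min g0 e0.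
Qed.

(** A constraint that is active at time [t] stays active shortly after [t], with
    a margin that good approximations inherit, so its inequality survives the
    limit.  This is not so shortly before [t], since the left limit of [phi] may
    lie on the face; there only the jump at [t] is controlled. *)
Lemma regulated_closed phi eta :
    (forall t : R, 0 <= t ->
      phi x - eta x @[x --> t^'+] --> phi t - eta t) ->
    (forall T e : R, 0 <= T -> 0 < e -> exists phi' eta', regulated phi' eta' /\
       forall t : R, 0 <= t <= T ->
         `|phi t - phi' t| <= e /\ `|eta t - eta' t| <= e) ->
  regulated phi eta.
Proof.
move=> drive_right approx.
have B0 := constraint_bound_gt0.
have cauchy_lim (t : R) : 0 < t -> exists q : 'rV[R]_J, eta x @[x --> t^'-] --> q.
  move=> t0; exists (lim (eta x @[x --> t^'-])); apply: cauchy_cvg.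
  apply: cauchy_exP => e e0.
  have e3 : 0 < e / 3 by rewrite divr_gt0.
  have [phi' [eta' [reg' close]]] := approx t _ (ltW t0) e3.
  have [q' eta'q _] := reg_jump reg' t0.
  exists q'; suff : \forall x \near t^'-, ball q' e (eta x) by [].
  near=> x; rewrite -ball_normE /ball_ /=.
  have xt : 0 <= x <= t.
    apply/andP; split; near: x; [exact: nbhs_left_ge | exact: nbhs_left_le].
  have [_ hx] := close x xt.
  have hq : `|q' - eta' x| <= e / 3.
    by near: x; move/cvgrPdist_le: eta'q; apply.
  by apply: (le_lt_trans (ler_distD (eta' x) _ _)); rewrite [`|eta' x - _|]distrC; lra.
have eta_right (t : R) : 0 <= t -> eta x @[x --> t^'+] --> eta t.
  move=> t0; apply/cvgrPdist_le => e e0.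
  have e3 : 0 < e / 3 by rewrite divr_gt0.
  have t1 : 0 <= t + 1 by rewrite addr_ge0.
  have [phi' [eta' [reg' close]]] := approx (t + 1) _ t1 e3.
  near=> x.
  have [|_ hx] := close x.
    apply/andP; split; first by apply: (le_trans t0); near: x; exact: nbhs_right_ge.
    by near: x; apply: nbhs_right_le; rewrite ltrDl.
  have [|_ ht] := close t; first by rewrite t0 lerDl ler01.
  have htx : `|eta' t - eta' x| <= e / 3.
    by near: x; move/cvgrPdist_le: (reg_right reg' t0); apply.
  apply: (le_trans (ler_distD (eta' t) _ _)); rewrite -lerBrDl.
  by apply: (le_trans (ler_distD (eta' x) _ _)); rewrite [`|eta' x - _|]distrC; lra.
have phi_right (t : R) : 0 <= t -> phi x @[x --> t^'+] --> phi t.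
  move=> t0.
  have : phi x - eta x + eta x @[x --> t^'+] --> phi t - eta t + eta t.
    by apply: cvgD; [exact: drive_right | exact: eta_right].
  have -> : (fun s : R => phi s - eta s + eta s) = phi.
    by apply/funext => x; rewrite subrK.
  by rewrite subrK.
apply: regulated_local.
- move=> t t0 i; rewrite leNgt; apply/negP => neg.
  have e0 : 0 < - phi t 0 i / 2 by rewrite divr_gt0 // oppr_gt0.
  have [phi' [eta' [reg' close]]] := approx t _ t0 e0.
  have [|+ _] := close t; first by rewrite t0 lexx.
  move=> /(le_trans (coord_le_norm _ i)); rewrite !mxE ler_norml => /andP[lo _].
  by have := reg_orthant reg' t0 i; lra.
- apply/eqP; rewrite -normr_le0; apply/ler_addgt0Pr => e e0; rewrite add0r.
  have [phi' [eta' [reg' close]]] := approx 0 _ (lexx _) e0.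
  have [|_] := close 0; first by rewrite lexx.
  by rewrite (reg_start reg') subr0.
- exact: eta_right.
- move=> t c t0 gt0; have g40 : 0 < gauge c (phi t) / 4 by rewrite divr_gt0.
  have [e1 [e10 e1g _]] := small_radius g40 g40.
  have /cvgrPdist_le/(_ _ e10)/near_rightP[d d0 Hd] := phi_right t t0.
  apply/near_rightP; exists d => // v tv.
  have v0 : 0 <= v by lra.
  apply/ler_addgt0Pr => e e0.
  have [e2 [e20 e2g e2e]] := small_radius g40 (divr_gt0 e0 (ltr0Sn R 1)).
  have [phi' [eta' [reg' close]]] := approx v _ v0 e20.
  have incr' : force c (eta' v - eta' t) <= 0.
    apply: (reg_incr reg'); first by rewrite t0; case/andP: tv.
    move=> u; rewrite /= in_itv /= => /andP[tu uv].
    have near_t := ler_wpM2l (ltW B0) (Hd u (introT andP (conj tu _))).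
    have [|near' _] := close u; first by rewrite uv andbT; lra.
    have := ler_wpM2l (ltW B0) near'.
    have := gauge_lipschitz c (phi u) (phi' u).
    have := gauge_lipschitz c (phi t) (phi u).
    rewrite !ler_norml.
    have : constraint_bound * `|phi t - phi u| <= constraint_bound * e1.
      by apply: near_t; lra.
    lra.
  have [|_ close_t] := close t; first by rewrite t0; lra.
  have [|_ close_v] := close v; first by rewrite v0 lexx.
  have := force_le c (eta t - eta' t); have := force_le c (eta v - eta' v).
  have := ler_wpM2l (ltW B0) close_t; have := ler_wpM2l (ltW B0) close_v.
  move: incr'; rewrite !ler_norml !forceB; lra.
- move=> t t0; have [q etaq] := cauchy_lim t t0; exists q => // c pos.
  have gt0 : 0 < gauge c (phi t) by exact: pos.
  have g40 : 0 < gauge c (phi t) / 4 by rewrite divr_gt0.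
  apply/ler_addgt0Pr => e e0; rewrite add0r.
  have [e2 [e20 e2g e2e]] := small_radius g40 (divr_gt0 e0 (ltr0Sn R 1)).
  have [phi' [eta' [reg' close]]] := approx t _ (ltW t0) e20.
  have [q' eta'q adm] := reg_jump reg' t0.
  have [|close_phi close_eta] := close t; first by rewrite ltW //=.
  have jump' : force c (eta' t - q') <= 0.
    apply: adm => _ ->.
    have := ler_wpM2l (ltW B0) close_phi.
    have := gauge_lipschitz c (phi t) (phi' t).
    rewrite !ler_norml; lra.
  have close_q : `|q - q'| <= e2.
    have lim_diff : `|eta x - eta' x| @[x --> t^'-] --> `|q - q'|.
      by apply: cvg_norm; exact: cvgB.
    apply: (cvgr_to_le lim_diff); near=> x; apply: (close x _).2.
    apply/andP; split; near: x; [exact: nbhs_left_ge | exact: nbhs_left_le].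
  have := force_le c (eta t - eta' t); have := force_le c (q - q').
  have := ler_wpM2l (ltW B0) close_eta; have := ler_wpM2l (ltW B0) close_q.
  move: jump'; rewrite !ler_norml !forceB; lra.
Unshelve. all: by end_near. Qed.

(** A regulated pair with a piecewise constant push, stopped at [T], whose
    driving path is within [e] of [psi] on [0, T].  Saying that [eta] is locally constant on each side
    of every time avoids naming a partition.  The error is 0 at [T], so that
    errors do not accumulate when the solution is extended. *)
Record step_solution psi (e T : R) phi eta : Prop := StepSolution {
  step_orthant : forall t, orthant (phi t);
  step_start : eta 0 = 0;
  step_right : forall t : R, 0 <= t -> \forall v \near t^'+, eta v = eta t;
  step_jump : forall t : R, 0 < t -> exists2 q : 'rV[R]_J,
    \forall v \near t^'-, eta v = q & admissible phi [set t] (eta t - q);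
  step_error : forall t : R, 0 <= t <= T -> `|phi t - eta t - psi t| <= e;
  step_exact : phi T - eta T = psi T;
  step_stop : forall t : R, T <= t -> phi t = phi T /\ eta t = eta T }.

Lemma step_solution_regulated psi e T phi eta :
  step_solution psi e T phi eta -> regulated phi eta.
Proof.
case=> G0 eta0 right_cst jump _ _ _; apply: regulated_local => //.
- by move=> t t0; apply: cvg_near_cst; exact: right_cst.
- move=> t c t0 _; near=> v; suff -> : eta v = eta t by [].
  by near: v; exact: right_cst.
- move=> t t0; have [q etaq adm] := jump t t0; exists q => //.
  exact: cvg_near_cst.
Unshelve. all: by end_near. Qed.

(** The pair is frozen until [T], where a projection absorbs the whole increment
    of [psi] since [T0] in one jump. *)
Lemma step_solution_extend psi (e T0 T : R) phi eta :
    0 < e -> 0 <= T0 < T ->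
    (forall u : R, T0 <= u < T -> `|psi T0 - psi u| <= e) ->
    step_solution psi e T0 phi eta ->
  exists phi' eta', step_solution psi e T phi' eta'.
Proof.
move=> e0 /andP[T00 T0T] osc [G0 eta0 right_cst jump err exact0 stop].
have [y [w [Gy yE adm_w]]] := gps_projection (phi T0 + (psi T - psi T0)).
pose phi' t := if t < T then phi t else y.
pose eta' t := if t < T then eta t else eta T0 + w.
have lo t : t < T -> phi' t = phi t /\ eta' t = eta t by rewrite /phi' /eta' => ->.
have hi t : T <= t -> phi' t = y /\ eta' t = eta T0 + w.
  by rewrite /phi' /eta' ltNge => ->.
have exactT : phi' T - eta' T = psi T.
  have [-> ->] := hi T (lexx _); rewrite yE opprD addrACA subrr addr0.
  by rewrite -addrA addrC -addrA [- eta T0 + _]addrC exact0 subrK.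
exists phi', eta'; split => //.
- by move=> t; rewrite /phi'; case: ifP.
- by have [_ ->] := lo 0 (le_lt_trans T00 T0T).
- move=> t t0; have [tT|Tt] := ltP t T.
    near=> v; have vT : v < T by near: v; exact: nbhs_right_lt.
    have [_ ->] := lo v vT; have [_ ->] := lo t tT.
    by near: v; exact: right_cst.
  near=> v; have tv : t <= v by near: v; exact: nbhs_right_ge.
  by have [_ ->] := hi v (le_trans Tt tv); have [_ ->] := hi t Tt.
- move=> t t0; have [tT|Tt|tT] := ltgtP t T.
  + have [q etaq adm] := jump t t0; exists q.
      near=> v; have vt : v < t by near: v; exact: nbhs_left_lt.
      have [_ ->] := lo v (lt_trans vt tT).
      by near: v; exact: etaq.
    have [_ ->] := lo t tT; move=> c pos; apply: adm => _ ->.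
    by have [<- _] := lo t tT; exact: pos.
  + exists (eta T0 + w).
      near=> v; have Tv : T <= v by near: v; exact: nbhs_left_ge.
      by have [_ ->] := hi v Tv.
    have [_ ->] := hi t (ltW Tt); move=> c _.
    by rewrite subrr force0.
  + exists (eta T0).
      near=> v; have vT : v < T by rewrite -tT; near: v; exact: nbhs_left_lt.
      have T0v : T0 <= v by near: v; apply: nbhs_left_ge; rewrite tT.
      by have [_ ->] := lo v vT; have [_ ->] := stop v T0v.
    have Tt : T <= t by rewrite tT.
    have [phiE ->] := hi t Tt; rewrite addrAC subrr add0r => c pos.
    by apply: adm_w; rewrite -phiE; exact: pos.
- move=> t /andP[t0 tT]; have [tlt|Tt] := ltP t T; last first.
    have -> : t = T by apply/le_anti; rewrite tT Tt.
    by rewrite exactT subrr normr0 ltW.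
  have [-> ->] := lo t tlt; have [tT0|T0t] := leP t T0; first by apply: err; rewrite t0 tT0.
  by have [-> ->] := stop t (ltW T0t); rewrite exact0; apply: osc; rewrite tlt ltW.
- by move=> t Tt; have [-> ->] := hi t Tt; have [-> ->] := hi T (lexx _).
Unshelve. all: by end_near. Qed.

Lemma step_solution_exists psi (e T : R) :
    cadlag_from orthant psi -> 0 < e -> 0 <= T ->
  exists phi eta, step_solution psi e T phi eta.
Proof.
move=> [[psi_right psi_left] G0] e0 T0.
pose Q (t : R) := exists phi eta, step_solution psi e t phi eta.
apply: (real_induction (a := 0) (b := T) (Q := Q)); last by rewrite T0 lexx.
- exists (fun=> psi 0), (fun=> 0); split=> //.
  + by move=> t _; exact: nearW.
  + move=> t _; exists 0; first exact: nearW.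
    by move=> c _; rewrite subrr -(scale0r 0) forceZ mul0r.
  + by move=> t t0; have -> : t = 0 by [apply/le_anti; rewrite andbC]; rewrite subr0 subrr normr0 ltW.
  + by rewrite subr0.
- move=> u /andP[u0 uT] [phi [eta sol]].
  have /cvgrPdist_le/(_ _ e0)/near_rightP[d d0 Hd] := psi_right u u0.
  apply/near_rightP; exists d => // v /andP[uv vd] _.
  apply: (step_solution_extend e0 _ _ sol); first by rewrite u0 uv.
  move=> s /andP[us sv]; have [<-|su] := eqVneq u s; first by rewrite subrr normr0 ltW.
  by apply: Hd; rewrite lt_neqAle su us (lt_trans sv).
- move=> u /andP[u0 uT] below.
  have e2 : 0 < e / 2 by rewrite divr_gt0.
  have /cvg_ex[l psil] := psi_left u u0.
  move/cvgrPdist_le: psil => /(_ _ e2)/near_leftP[d d0 Hd].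
  pose r := Num.max 0 (u - d / 2).
  have r0 : 0 <= r by rewrite le_max lexx.
  have ru : r < u by rewrite gt_max u0; lra.
  have dr : u - d < r by rewrite lt_max; apply/orP; right; lra.
  have [phi [eta sol]] := below r (introT andP (conj r0 ru)).
  apply: (step_solution_extend e0 _ _ sol); first by rewrite r0 ru.
  move=> s /andP[rs su]; apply: (le_trans (ler_distD l _ _)); rewrite (splitr e).
  by apply: lerD; [rewrite distrC|]; apply: Hd; apply/andP; split; lra.
Qed.

Lemma lipschitz_factor_ge0 : 0 <= lipschitz_factor.
Proof.
have A0 := inv_weights_ge0.
by rewrite /lipschitz_factor /osc_factor !(addr_ge0, mulr_ge0).
Qed.

(** The step solutions with error 1 / (n + 1) on [0, n] form a Cauchy sequence by
    the Lipschitz estimate. *)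
Lemma regulated_exists psi : cadlag_from orthant psi ->
  exists eta, regulated (fun t => psi t + eta t) eta.
Proof.
move=> psi_cadlag; have L0 := lipschitz_factor_ge0.
pose e n : R := n.+1%:R^-1.
have e_gt0 n : 0 < e n by rewrite invr_gt0.
have /choice[p p_sol] : forall n, exists p : (R -> 'rV[R]_J) * (R -> 'rV[R]_J),
    step_solution psi (e n) n%:R p.1 p.2.
  move=> n; have [phi [eta sol]] := step_solution_exists psi_cadlag (e_gt0 n) (ler0n R n).
  by exists (phi, eta).
have reg n : regulated (p n).1 (p n).2 := step_solution_regulated (p_sol n).
have close m n (t : R) : (n <= m)%N -> 0 <= t <= n%:R ->
    `|(p n).2 t - (p m).2 t| <= lipschitz_factor * (2 * e n).
  move=> nm tn; apply: (regulated_lipschitz (reg n) (reg m) _ _ tn).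
    by rewrite mulr_gt0.
  move=> s /andP[s0 sn]; apply: (le_trans (ler_distD (psi s) _ _)).
  rewrite mulr_natl mulr2n; apply: lerD.
    by apply: (step_error (p_sol n)); rewrite s0.
  rewrite distrC; apply: (@le_trans _ _ (e m)).
    by apply: (step_error (p_sol m)); rewrite s0 (le_trans sn) // ler_nat.
  by rewrite lef_pV2 ?posrE // ler_nat.
have eventually_close (T r : R) : 0 < r -> exists n,
    T <= n%:R /\ (2 * lipschitz_factor + 1) * e n <= r.
  move=> r0; have K0 : 0 < 2 * lipschitz_factor + 1 by rewrite ltr_wpDl // mulr_ge0.
  have d0 : 0 < (2 * lipschitz_factor + 1)^-1 * r by rewrite mulr_gt0 // invr_gt0.
  near \oo => n; exists n; split; first by near: n; exact: nbhs_infty_ger.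
  rewrite -ler_pdivlMl // ltW //; near: n.
  exact: (near_infty_natSinv_lt (PosNum d0)).
have lim_eta (t : R) : 0 <= t -> cvg ((p n).2 t @[n --> \oo]).
  move=> t0; apply: cauchy_cvg; apply: cauchy_exP => r r0.
  have [n [tn en]] := eventually_close t (r / 2) (divr_gt0 r0 (ltr0Sn R 1)).
  exists ((p n).2 t).
  suff : \forall m \near \oo, ball ((p n).2 t) r ((p m).2 t) by [].
  exists n => // m /= nm; rewrite -ball_normE /ball_ /=.
  apply: (@le_lt_trans _ _ (r / 2)); last by lra.
  apply: (le_trans (close m n t nm _)); first by rewrite t0.
  by move: en; have := e_gt0 n; lra.
pose eta (t : R) : 'rV[R]_J := lim ((p n).2 t @[n --> \oo]).
have close_lim n (t : R) : 0 <= t <= n%:R ->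
    `|(p n).2 t - eta t| <= lipschitz_factor * (2 * e n).
  move=> /andP[t0 tn].
  have lim_dist : `|(p n).2 t - (p m).2 t| @[m --> \oo] --> `|(p n).2 t - eta t|.
    by apply: cvg_norm; apply: cvgB; [exact: cvg_cst | exact: lim_eta].
  apply: (cvgr_to_le lim_dist); exists n => // m /= nm.
  by apply: close => //; rewrite t0.
have eta_closed (T r : R) : 0 <= T -> 0 < r -> exists phi' eta', regulated phi' eta' /\
    forall t : R, 0 <= t <= T ->
      `|psi t + eta t - phi' t| <= r /\ `|eta t - eta' t| <= r.
  move=> T0 r0; have [n [Tn en]] := eventually_close T r r0.
  exists (p n).1, (p n).2; split=> // t /andP[t0 tT].
  have tn : 0 <= t <= n%:R by rewrite t0 (le_trans tT).
  have close_eta : `|eta t - (p n).2 t| <= 2 * lipschitz_factor * e n.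
    by rewrite distrC; apply: (le_trans (close_lim n t tn)); lra.
  have en0 := e_gt0 n; split; last by lra.
  have -> : psi t + eta t - (p n).1 t =
      (eta t - (p n).2 t) - ((p n).1 t - (p n).2 t - psi t).
    by apply/rowP => i; rewrite !mxE; lra.
  apply: (le_trans (ler_normB _ _)).
  by have := step_error (p_sol n) tn; lra.
exists eta; apply: regulated_closed eta_closed => t t0.
under eq_cvg do rewrite addrK.
rewrite addrK; exact: psi_cadlag.1.1.
Unshelve. all: by end_near. Qed.

(** * Back to the extended Skorokhod problem *)

Lemma left_limitE eta (t : R) (q : 'rV[R]_J) :
  0 < t -> eta x @[x --> t^'-] --> q -> left_limit eta t = q.
Proof. by move=> t0 etaq; rewrite /left_limit t0; apply: cvg_lim. Qed.

Lemma solves_ESP_regulated psi phi eta :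
  solves_ESP orthant (gps_d alpha) psi phi eta -> regulated phi eta.
Proof.
case=> _ [eta_right eta_left] phi0 sol.
have G0 (t : R) : 0 <= t -> orthant (phi t) by move=> /sol[].
split => //.
- have [phi0E _ _ _] := sol 0 (lexx 0); move: phi0E; rewrite phi0 => /eqP.
  by rewrite -subr_eq0 opprD addrA subrr sub0r oppr_eq0 => /eqP.
- move=> s t /andP[s0 st].
  have [_ _ /(_ s) incr _] := sol t (le_trans s0 (ltW st)).
  apply: closed_convex_hull_admissible; last by apply: incr; rewrite s0.
  by move=> u; rewrite /= in_itv /= => /andP[su _]; apply: G0; lra.
- move=> t t0; have /cvg_ex[q etaq] := eta_left t t0; exists q => //.
  have [_ _ _] := sol t (ltW t0).
  rewrite (left_limitE t0 etaq) => hull.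
  apply: closed_convex_hull_admissible; first by move=> u ->; exact/G0/ltW.
  by rewrite bigcup_set1.
Qed.

Lemma regulated_solves_ESP psi eta : cadlag_from orthant psi ->
    regulated (fun t => psi t + eta t) eta ->
  solves_ESP orthant (gps_d alpha) psi (fun t => psi t + eta t) eta.
Proof.
move=> [[psi_right psi_left] psi0] [G0 eta0 eta_right incr jump].
have eta_left (t : R) : 0 < t -> cvg (eta x @[x --> t^'-]).
  by move=> t0; have [q etaq _] := jump t t0; apply/cvg_ex; exists q.
split.
- split; last exact: G0.
  split=> t t0; first by apply: cvgD; [exact: psi_right | exact: eta_right].
  by apply: is_cvgD; [exact: psi_left | exact: eta_left].
- by split.
- by rewrite eta0 addr0.
- move=> t t0; split => //; first exact: G0.
    move=> s /andP[s0 st]; apply: admissible_closed_convex_hull.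
    + by exists t; rewrite /= in_itv /= st lexx.
    + by move=> u; rewrite /= in_itv /= => /andP[su _]; apply: G0; lra.
    + by apply: incr; rewrite s0.
  have -> : gps_d alpha (psi t + eta t) =
      \bigcup_(u in [set t]) gps_d alpha (psi u + eta u) by rewrite bigcup_set1.
  apply: (@admissible_closed_convex_hull (fun t => psi t + eta t)).
  + by exists t.
  + by move=> u ->; exact: G0.
  + have [tpos|tneg] := ltP 0 t.
      have [q etaq adm] := jump t tpos.
      by rewrite (left_limitE tpos etaq).
    have -> : t = 0 by apply/le_anti; rewrite tneg.
    move=> c _; rewrite /left_limit ltxx subrr.
    by rewrite force0.
Qed.

Definition enorm_factor : R := J%:R * (lipschitz_factor + 1).

Lemma ESM_gps_lipschitz : ESM_lipschitz orthant (gps_d alpha).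
Proof.
have L0 := lipschitz_factor_ge0.
have J0 : 0 < J%:R :> R by rewrite ltr0n (ltnW J_ge2).
have l0 : 0 < enorm_factor by rewrite mulr_gt0 // ltr_wpDl.
exists enorm_factor => T T0 psi1 psi2 phi1 phi2 _ _ sol1 sol2.
have reg1 := solves_ESP_regulated sol1; have reg2 := solves_ESP_regulated sol2.
set M := sup_enorm (fun t => psi1 t - psi2 t) T.
have psiM (t : R) : 0 <= t <= T -> ((enorm (psi1 t - psi2 t))%:E <= M)%E.
  by move=> tT; apply: ereal_sup_ubound; exists t => //=; rewrite in_itv.
have M0 : (0 <= M)%E.
  by apply: le_trans (psiM 0 _); rewrite ?lexx ?T0 // lee_fin sqrtr_ge0.
apply: ge_ereal_sup => _ [t /= + <-]; rewrite in_itv /= => tT.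
move: M0 psiM; case: M => [m||] // M0 psiM; last by rewrite gt0_muley // leey.
rewrite -EFinM lee_fin.
apply/ler_addgt0Pr => r r0.
(* the estimate requires a positive bound on the driving paths, and m may be 0 *)
pose D := m + r / enorm_factor.
have D0 : 0 < D by rewrite ltr_wpDl // divr_gt0.
have -> : enorm_factor * m + r = J%:R * (lipschitz_factor * D + D).
  rewrite /D /enorm_factor; field.
  by rewrite !gt_eqF // ltr_wpDl.
apply: (le_trans (enorm_le_norm _)); rewrite ler_pM2l //.
have drive (s : R) : 0 <= s <= T ->
    `|(phi1 s - (phi1 s - psi1 s)) - (phi2 s - (phi2 s - psi2 s))| <= D.
  move=> /psiM; rewrite !subKr lee_fin => psi_m.
  by apply: (le_trans (norm_le_enorm _)); apply: (le_trans psi_m); rewrite lerDl divr_ge0 // ltW.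
have est := regulated_lipschitz reg1 reg2 D0 drive tT.
have -> : phi1 t - phi2 t = (phi1 t - psi1 t - (phi2 t - psi2 t)) + (psi1 t - psi2 t).
  by apply/rowP => i; rewrite !mxE; lra.
apply: (le_trans (ler_normD _ _)); apply: lerD est _.
by have := drive t tT; rewrite !subKr.
Qed.

(** Equal driving paths are within every positive distance of each other. *)
Lemma regulated_unique psi phi eta phi' eta' :
    regulated phi eta -> regulated phi' eta' ->
    (forall t : R, 0 <= t -> phi t = psi t + eta t) ->
    (forall t : R, 0 <= t -> phi' t = psi t + eta' t) ->
  eq_paths eta' eta.
Proof.
move=> reg reg' phiE phi'E t t0.
apply/eqP; rewrite -subr_eq0 -normr_le0; apply/ler_addgt0Pr => r r0; rewrite add0r.
have L1 : 0 < lipschitz_factor + 1 by rewrite ltr_wpDl // lipschitz_factor_ge0.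
have D0 : 0 < r / (lipschitz_factor + 1) by rewrite divr_gt0.
have tt : 0 <= t <= t by rewrite t0 lexx.
apply: (le_trans (regulated_lipschitz reg' reg D0 _ tt)).
  move=> s /andP[s0 _]; rewrite phiE // phi'E // !addrK subrr normr0 ltW //.
rewrite mulrCA; apply: ler_piMr; first exact: ltW.
by rewrite ler_pdivrMr // mul1r lerDl.
Qed.

End GPS.

Theorem theorem3p6 (R : realType) (J : nat) (alpha : 'I_J -> R)
    (J_ge2 : (2 <= J)%N)
    (alpha_gt0 : forall i, 0 < alpha i)
    (alpha_sum1 : \sum_(i < J) alpha i = 1) :
  (forall psi : R -> 'rV[R]_J, cadlag_from orthant psi ->
     exists phi eta : R -> 'rV[R]_J,
       solves_ESP orthant (gps_d alpha) psi phi eta /\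
       forall phi' eta' : R -> 'rV[R]_J,
         solves_ESP orthant (gps_d alpha) psi phi' eta' ->
         eq_paths phi' phi /\ eq_paths eta' eta) /\
  ESM_lipschitz orthant (gps_d alpha).
Proof.
split; last exact: ESM_gps_lipschitz.
move=> psi psi_cadlag.
have [eta reg] := regulated_exists J_ge2 alpha_gt0 alpha_sum1 psi_cadlag.
have sol := regulated_solves_ESP J_ge2 alpha_gt0 alpha_sum1 psi_cadlag reg.
exists (fun t => psi t + eta t), eta; split=> // phi' eta' sol'.
have reg' := solves_ESP_regulated J_ge2 alpha_gt0 alpha_sum1 sol'.
have phi'E (t : R) : 0 <= t -> phi' t = psi t + eta' t.
  by move=> t0; case: sol' => _ _ _ /(_ t t0)[].
have etaE := regulated_unique J_ge2 alpha_gt0 alpha_sum1 reg reg'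
  (fun _ _ => erefl) phi'E.
by split=> // t t0; rewrite phi'E // etaE.
Qed.
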